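(* For every positive integer $n$, during a complete run of $\mathrm{RuleAsc}(n)$, the two statements ''$y\leftarrow a_k-1$'' and ''$x\leftarrow a_k+1$'' (the read operations of the algorithm) are executed a total of exactly $2p(n)$ times.
   Context: $p(n)$ denotes the number of partitions of $n$. The procedure $\mathrm{RuleAsc}(n)$, for $n>0$, operates on an array $a$ as follows and visits every ascending composition of $n$ (a sequence of positive integers in nondecreasing order summing to $n$) exactly once, in lexicographic order: 1. $k\leftarrow 2$; $a_1\leftarrow 0$; $a_2\leftarrow n$. 2. While $k\ne 1$: - $y\leftarrow a_k-1$; $k\leftarrow k-1$; $x\leftarrow a_k+1$. - While $x\le y$: $a_k\leftarrow x$; $y\leftarrow y-x$; $k\leftarrow k+1$. - $a_k\leftarrow x+y$; visit $\langle a_1,\dots,a_k\rangle$. *)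

(* Defs.v *)
From HB Require Import structures.
From mathcomp Require Import all_boot all_order all_algebra.

Set Implicit Arguments.
Unset Strict Implicit.
Unset Printing Implicit Defensive.

Definition is_partition (n : nat) (s : seq nat) : bool :=
  [&& sorted geq s, 0 \notin s & sumn s == n].

Lemma is_partition_bounded (n : nat) (s : seq nat) :
  is_partition n s -> size s <= n /\ all (fun m => m <= n) s.
Proof.
case/and3P=> _ s0 /eqP <-; elim: s s0 => [//|m s IHs] /=.
rewrite inE negb_or eq_sym -lt0n => /andP[m_gt0 /IHs[le_s all_s]].
split; first by rewrite -add1n leq_add.
rewrite leq_addr; apply: sub_all all_s => i /leq_trans; apply.
exact: leq_addl.
Qed.

(* By [is_partition_bounded], a partition of n has at most n parts, all of    *)
(* them at most n, so no partition is lost by counting, for each number k <= n *)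
(* of parts, among the k-tuples over {0, ..., n}.                              *)
Definition num_partitions (n : nat) : nat :=
  \sum_(k < n.+1)
    #|[set t : k.-tuple 'I_n.+1 | is_partition n [seq val i | i <- t]]|.

(* A small imperative language over the integers, with three scalar variables *)
(* and one unbounded array.                                                   *)
Inductive var := K | X | Y.

Inductive expr :=
  | Cst of int
  | Var of var
  | Arr of expr
  | Plus of expr & expr
  | Minus of expr & expr.

Inductive stmt :=
  | Assign of var & expr
  | Store of expr & expr   (* [Store i e] is the assignment of e to a_i *)
  | Visit of expr.         (* [Visit e] visits <a_1, ..., a_e> *)

Inductive test :=
  | Le of expr & expr
  | Neq of expr & expr.

Inductive cmd :=
  | Do of stmt
  | Seq of cmd & cmd
  | While of test & cmd.

Definition var_comparable : comparable var.
Proof. by rewrite /comparable /decidable; decide equality. Defined.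
HB.instance Definition _ := hasDecEq.Build var (compareP var_comparable).

Definition expr_comparable : comparable expr.
Proof.
by rewrite /comparable /decidable; decide equality; exact: eq_comparable.
Defined.
HB.instance Definition _ := hasDecEq.Build expr (compareP expr_comparable).

Definition stmt_comparable : comparable stmt.
Proof.
by rewrite /comparable /decidable; decide equality; exact: eq_comparable.
Defined.
HB.instance Definition _ := hasDecEq.Build stmt (compareP stmt_comparable).

Record state := State { var_val : var -> int; arr_val : int -> int }.

Fixpoint eval (s : state) (e : expr) : int :=
  match e with
  | Cst c => c
  | Var v => var_val s v
  | Arr i => arr_val s (eval s i)
  | Plus e1 e2 => (eval s e1 + eval s e2)%R
  | Minus e1 e2 => (eval s e1 - eval s e2)%R
  end.

Definition holds (s : state) (b : test) : bool :=
  match b with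
  | Le e1 e2 => (eval s e1 <= eval s e2)%R
  | Neq e1 e2 => eval s e1 != eval s e2
  end.

(* Visiting only inspects the state. *)
Definition perform (c : stmt) (s : state) : state :=
  match c with
  | Assign v e => State [eta var_val s with v |-> eval s e] (arr_val s)
  | Store i e => State (var_val s) [eta arr_val s with eval s i |-> eval s e]
  | Visit _ => s
  end.

(* [exec c s tr s']: a complete run of c from state s terminates in state s',  *)
(* and tr lists the statements executed, in order and with repetitions.       *)
Inductive exec : cmd -> state -> seq stmt -> state -> Prop :=
  | exec_do c s :
      exec (Do c) s [:: c] (perform c s)
  | exec_seq c1 c2 s1 s2 s3 tr1 tr2 :
      exec c1 s1 tr1 s2 -> exec c2 s2 tr2 s3 ->
      exec (Seq c1 c2) s1 (tr1 ++ tr2) s3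
  | exec_while_false b c s :
      ~~ holds s b -> exec (While b c) s [::] s
  | exec_while_true b c s1 s2 s3 tr1 tr2 :
      holds s1 b -> exec c s1 tr1 s2 -> exec (While b c) s2 tr2 s3 ->
      exec (While b c) s1 (tr1 ++ tr2) s3.

Declare Scope prog_scope.
Delimit Scope prog_scope with prog.
Bind Scope prog_scope with expr stmt test cmd.

Coercion Cst : int >-> expr.
Coercion Var : var >-> expr.
Coercion Do : stmt >-> cmd.
Notation "e1 + e2" := (Plus e1 e2) : prog_scope.
Notation "e1 - e2" := (Minus e1 e2) : prog_scope.
Notation "e1 <= e2" := (Le e1 e2) : prog_scope.
Notation "e1 != e2" := (Neq e1 e2) : prog_scope.
Notation "v <~ e" := (Assign v e) (at level 75, no associativity) : prog_scope.
Notation "'a[' i ]" := (Arr i) (at level 0, i at level 60) : prog_scope.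
Notation "'a[' i ]<~ e" := (Store i e)
  (at level 0, i at level 60, e at level 60) : prog_scope.
Notation "c1 ;; c2" := (Seq c1 c2) (at level 80, right associativity) : prog_scope.

Definition read_y : stmt := (Y <~ a[K] - 1%Z)%prog.
Definition read_x : stmt := (X <~ a[K] + 1%Z)%prog.

Definition RuleAsc (n : nat) : cmd := (
  K <~ 2%Z ;;
  a[1%Z]<~ 0%Z ;;
  a[2%Z]<~ Posz n ;;
  While (K != 1%Z) (
    read_y ;;
    K <~ K - 1%Z ;;
    read_x ;;
    While (X <= Y) (
      a[K]<~ X ;;
      Y <~ Y - X ;;
      K <~ K + 1%Z) ;;
    a[K]<~ X + Y ;;
    Visit K))%prog.

(* Main.v *)
(* Let Q m s be the number of ascending compositions of s with all parts >= m.
   When <a_1, ..., a_k> has just been visited, the compositions that remain to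
   be visited are those whose first difference with it, at some i < k, is an
   increase; so there are sum_(i < k) Q (a_i + 1) (a_i + ... + a_k) of them.
   The recurrence Q m s = Q (m + 1) s + Q m (s - m) shows that each iteration of
   the outer loop decreases this number by exactly one, from Q 1 n = p(n) at the
   start down to the empty sum, reached when k = 1. *)
Require Import Defs.
From mathcomp Require Import all_boot all_order all_algebra.
From mathcomp Require Import zify.

(** * Enumeration of ascending compositions *)

Fixpoint asc_rec (fuel m s : nat) : seq (seq nat) :=
  if fuel is fuel'.+1 then
    if s == 0 then [:: [::]] else
    if m <= s then
      asc_rec fuel' m.+1 s ++ map (cons m) (asc_rec fuel' m (s - m))
    else [::]
  else [::].

(* Junk for m = 0, where there are infinitely many compositions. *)
Definition asc_compositions (m s : nat) : seq (seq nat) :=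
  asc_rec (s + s).+2 m s.

Definition num_asc (m s : nat) : nat := size (asc_compositions m s).

(** Both recursive calls lower the measure [s + (s.+1 - m)], which never reaches [(s + s).+2]; hence
    the recurrence below can be stated without fuel. *)
Lemma asc_rec_fuel (f f' m s : nat) :
  0 < m -> s + (s.+1 - m) < f -> s + (s.+1 - m) < f' ->
  asc_rec f m s = asc_rec f' m s.
Proof.
elim: f f' m s => [|f IHf] [|f'] m s //= m_gt0 lt_f lt_f'.
case: eqP => // s_neq0; case: leqP => // le_ms.
by rewrite (IHf f' m.+1) ?(IHf f' m) //; lia.
Qed.

Lemma asc_compositions_rec (m s : nat) : 0 < m -> m <= s ->
  asc_compositions m s =
    asc_compositions m.+1 s ++ map (cons m) (asc_compositions m (s - m)).
Proof.
move=> m_gt0 le_ms; rewrite {1}/asc_compositions.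
move def_f: (s + s).+1 => f /=; rewrite le_ms ifN; last by lia.
rewrite (asc_rec_fuel f (s + s).+2) ?(asc_rec_fuel f (s - m + (s - m)).+2) //;
  by lia.
Qed.

Lemma asc_compositions0 (m : nat) : asc_compositions m 0 = [:: [::]].
Proof. by []. Qed.

Lemma asc_compositions_lt (m s : nat) :
  0 < s < m -> asc_compositions m s = [::].
Proof.
case/andP=> s_gt0 lt_sm; rewrite /asc_compositions /=.
by rewrite ifN ?ifN //; lia.
Qed.

(** The two halves of the recurrence separate compositions by their first part: greater than [m], or
    equal to [m]. *)
Lemma mem_asc_compositions (m s : nat) (l : seq nat) : 0 < m ->
  (l \in asc_compositions m s) = path leq m l && (sumn l == s).
Proof.
have [f] := ubnP (s + (s.+1 - m)).
elim: f m s l => // f IHf m s l lt_f m_gt0.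
have [->|s_gt0] := posnP s.
  rewrite asc_compositions0 inE; case: l => [|x l] //=.
  rewrite addn_eq0; case: (leqP m x) => //= le_mx.
  by rewrite (_ : x == 0 = false) ?andbF //; lia.
have [lt_sm|le_ms] := ltnP s m.
  rewrite asc_compositions_lt ?s_gt0 // in_nil; case: l => [|x l] /=; first lia.
  by case: (leqP m x) => //= le_mx; rewrite gtn_eqF ?andbF //; lia.
rewrite asc_compositions_rec // mem_cat IHf //; last by lia.
case: l => [|x l] /=.
  by rewrite ltn_eqF //; apply/negbTE/mapP => -[].
have -> : (x :: l \in map (cons m) (asc_compositions m (s - m)))
    = (x == m) && (l \in asc_compositions m (s - m)).
  apply/mapP/andP => [[l' l'P [-> ->]]|[/eqP-> lP]]; first by rewrite eqxx.
  by exists l.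
rewrite IHf //; last by lia.
case: (ltngtP m x) => [lt_mx|//|<-] /=; first by rewrite orbF.
by case: path => //=; lia.
Qed.

Lemma uniq_asc_compositions (m s : nat) : 0 < m -> uniq (asc_compositions m s).
Proof.
have [f] := ubnP (s + (s.+1 - m)).
elim: f m s => // f IHf m s lt_f m_gt0.
have [->//|s_gt0] := posnP s.
have [lt_sm|le_ms] := ltnP s m; first by rewrite asc_compositions_lt ?s_gt0.
rewrite asc_compositions_rec // cat_uniq map_inj_uniq => [|l l' []//].
rewrite !IHf ?andbT //=; try by lia.
apply/hasPn => _ /mapP[l _ ->]; rewrite mem_asc_compositions //=.
by rewrite ltnn.
Qed.

Lemma num_asc_rec (m s : nat) : 0 < m -> m <= s ->
  num_asc m s = num_asc m.+1 s + num_asc m (s - m).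
Proof.
by move=> *; rewrite /num_asc asc_compositions_rec // size_cat size_map.
Qed.

(** Two parts, each at least [x], would already exceed [x + y], so only the one-part composition
    remains. *)
Lemma num_asc1 (x y : nat) : y < x -> num_asc x (x + y) = 1.
Proof.
elim: y x => [|y IHy] x lt_yx; rewrite num_asc_rec ?leq_addr ?addKn //; try lia.
  by rewrite /num_asc asc_compositions_lt ?asc_compositions0 //; lia.
rewrite addnS -addSn IHy; last by lia.
by rewrite /num_asc asc_compositions_lt //; lia.
Qed.

(** * Partitions as reversed ascending compositions *)

Lemma num_partitions_size (n : nat) (L : seq (seq nat)) :
  uniq L -> L =i is_partition n -> num_partitions n = size L.
Proof.
move=> uniqL memL.
transitivity (\sum_(k < n.+1) \sum_(l <- L | size l == k) 1).
  apply: eq_bigr => k _; rewrite sum1_count cardE -(size_map (fun t => map val (tval t))).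
  rewrite -size_filter; apply/perm_size/uniq_perm.
  - rewrite map_inj_uniq ?enum_uniq // => t1 t2 /inj_map eq_t.
    by apply: val_inj; apply: eq_t; exact: val_inj.
  - exact: filter_uniq.
  move=> l; rewrite mem_filter memL; apply/mapP/andP => [[t]|[/eqP size_l lP]].
    by rewrite mem_enum inE => tP ->; rewrite size_map size_tuple.
  have [_ /allP le_ln] := is_partition_bounded lP.
  (* [inord] sends values above [n] to a default, but all parts of [l] are at most [n]. *)
  have size_t : size (map (@inord n) l) == k by rewrite size_map size_l.
  have val_t : l = map val (map (@inord n) l).
    by rewrite -map_comp map_id_in // => i /le_ln le_in; rewrite /= inordK.
  by exists (Tuple size_t) => //; rewrite mem_enum inE /= -val_t.
rewrite -[RHS](count_predT) -sum1_count.
(* After the exchange, each [l] is counted once, at [k = size l], which is in range since a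
   partition of [n] has at most [n] parts. *)
rewrite (exchange_big_dep xpredT) //= big_seq [RHS]big_seq.
apply: eq_bigr => l; rewrite memL => /is_partition_bounded[le_ln _].
by rewrite (big_pred1 (Ordinal (le_ln : size l < n.+1))).
Qed.

Lemma num_partitions_asc (n : nat) : num_partitions n = num_asc 1 n.
Proof.
rewrite /num_asc -(size_map rev); apply: num_partitions_size.
  by rewrite (map_inj_uniq (can_inj revK)) uniq_asc_compositions.
move=> l; rewrite -[l]revK (mem_map (can_inj revK)) mem_asc_compositions //.
rewrite unfold_in /is_partition rev_sorted mem_rev !sumn_rev.
rewrite path_sortedE; last exact: leq_trans.
rewrite andbA [all _ _ && _]andbC -has_pred1 -all_predC.
by congr (_ && _ && _); apply: eq_all => -[].
Qed.

(** * Runs of programs and the array as a stack *)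

(** This transfers the count from one constructed run to every run. *)
Lemma exec_deterministic (c : cmd) (s : state) (tr1 tr2 : seq stmt)
    (s1 s2 : state) :
  exec c s tr1 s1 -> exec c s tr2 s2 -> tr1 = tr2 /\ s1 = s2.
Proof.
move=> run1; elim: run1 tr2 s2 => {c s tr1 s1}.
- by move=> c s tr2 s2 run2; inversion run2.
- move=> c1 c2 s s' s1 tr tr' _ IH1 _ IH2 tr2 s2 run2; inversion run2; subst.
  have [-> ?] := IH1 _ _ ltac:(eassumption); subst.
  by have [-> ->] := IH2 _ _ ltac:(eassumption).
- move=> b c s not_b tr2 s2 run2; inversion run2; subst => //.
  by case/negP: not_b.
- move=> b c s s' s1 tr tr' holds_b _ IH1 _ IH2 tr2 s2 run2.
  inversion run2; subst; first by case: (negP (ltac:(eassumption) : ~~ holds _ _)).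
  have [-> ?] := IH1 _ _ ltac:(eassumption); subst.
  by have [-> ->] := IH2 _ _ ltac:(eassumption).
Qed.

(* The stack l lists the array from the top down: l = [:: a_k; ...; a_1]. *)
Fixpoint stores (a : int -> int) (l : seq nat) : Prop :=
  if l is x :: l' then a (Posz (size l)) = Posz x /\ stores a l' else True.

Lemma stores_push (a : int -> int) (l : seq nat) (i v : int) (x : nat) :
  stores a l -> i = Posz (size l).+1 -> v = Posz x ->
  stores [eta a with i |-> v] (x :: l).
Proof.
move=> sto_l -> ->; split; first by rewrite /= eqxx.
have: size l < (size l).+1 by [].
(* The written index is generalized to any [j] above [size l], so that it stays fixed while [l]
   shrinks. *)
elim: l {2 3}(size l).+1 sto_l => //= y l IHl j [a_y sto_l] lt_j; split.
  by rewrite ifN //; lia.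
by apply: IHl => //; lia.
Qed.

(** The top of the stack is kept apart as [t], because during the inner loop it is not yet stored
    but held as [x + y] in the scalars. *)
Fixpoint remaining (l : seq nat) (t : nat) : nat :=
  if l is x :: l' then num_asc x.+1 (x + t) + remaining l' (x + t) else 0.

Definition inner_loop : cmd :=
  While (X <= Y)%prog (a[K]<~ X ;; Y <~ Y - X ;; K <~ K + 1%Z)%prog.

Definition outer_body : cmd :=
  (read_y ;;
   K <~ K - 1%Z ;;
   read_x ;;
   inner_loop ;;
   a[K]<~ X + Y ;;
   Visit K)%prog.

(** The right-hand side of the last equation is a loop invariant: pushing [x] splits
    [num_asc x (x + y)] into the term that [x] adds to [remaining] and [num_asc x y]. On exit
    [num_asc1] leaves the 1 of the successor. *)
Lemma exec_inner_loop (s : state) (l : seq nat) (x y : nat) :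
  0 < x -> var_val s X = Posz x -> var_val s Y = Posz y ->
  var_val s K = Posz (size l).+1 -> stores (arr_val s) l ->
  exists tr s' l' y',
    [/\ exec inner_loop s tr s',
        count_mem read_y tr = 0 /\ count_mem read_x tr = 0,
        [/\ var_val s' X = Posz x, var_val s' Y = Posz y' &
            var_val s' K = Posz (size l').+1],
        stores (arr_val s') l' &
        (remaining l' (x + y')).+1 = num_asc x (x + y) + remaining l (x + y)].
Proof.
have [f] := ubnP y.
elim: f y s l => // f IHf y s l lt_f x_gt0 sX sY sK sto_l.
have [le_xy|lt_yx] := leqP x y; last first.
  exists [::], s, l, y; split => //; last by rewrite num_asc1.
  by apply: exec_while_false; rewrite /= sX sY; lia.
set s1 := perform (a[K]<~ X)%prog s.
set s2 := perform (Y <~ Y - X)%prog s1.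
set s3 := perform (K <~ K + 1%Z)%prog s2.
have s3Y : var_val s3 Y = Posz (y - x) by rewrite /= sX sY; lia.
have s3K : var_val s3 K = Posz (size l).+2 by rewrite /= sK; lia.
have lt_yxf : y - x < f by lia.
have := IHf _ s3 (x :: l) lt_yxf x_gt0 sX s3Y s3K (stores_push _ _ _ _ _ sto_l sK sX).
move=> [tr [s' [l' [y' [run [cnt_y cnt_x] vars sto_l' rem]]]]].
exists ([:: (a[K]<~ X)%prog; (Y <~ Y - X)%prog; (K <~ K + 1%Z)%prog] ++ tr).
exists s', l', y'; split => //.
- apply: (exec_while_true (s2 := s3)) run; first by rewrite /= sX sY; lia.
  by apply: (exec_seq (tr1 := [:: _])); [|apply: (exec_seq (tr1 := [:: _]))];
    exact: exec_do.
rewrite rem /= subnKC // [num_asc x (x + y)]num_asc_rec ?leq_addr // addKn.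
by lia.
Qed.

Lemma exec_outer_body (s : state) (l : seq nat) (x t : nat) :
  0 < t -> var_val s K = Posz (size l).+2 -> stores (arr_val s) [:: t, x & l] ->
  exists tr s' l' t',
    [/\ exec outer_body s tr s',
        count_mem read_y tr = 1 /\ count_mem read_x tr = 1,
        0 < t' /\ var_val s' K = Posz (size l').+1,
        stores (arr_val s') (t' :: l') &
        (remaining l' t').+1 = remaining (x :: l) t].
Proof.
move=> t_gt0 sK /= [a_t [a_x sto_l]].
set s1 := perform read_y s.
set s2 := perform (K <~ K - 1%Z)%prog s1.
set s3 := perform read_x s2.
have s2K : var_val s2 K = Posz (size l).+1 by rewrite /= sK; lia.
have s3X : var_val s3 X = Posz x.+1.
  by rewrite /s3 /= -/(var_val s2 K) sK (_ : _ - _ = Posz (size l).+1)%R ?a_x; lia.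
have s3Y : var_val s3 Y = Posz t.-1 by rewrite /= sK a_t; lia.
have [] := @exec_inner_loop s3 l x.+1 t.-1 => //.
move=> tr [s4 [l' [y' [run [cnt_y cnt_x] [s4X s4Y s4K] sto_l' rem]]]].
set s5 := perform (a[K]<~ X + Y)%prog s4.
exists ([:: read_y; (K <~ K - 1%Z)%prog; read_x] ++ tr ++
        [:: (a[K]<~ X + Y)%prog; Visit K]).
exists s5, l', (x.+1 + y'); split => //.
- rewrite /outer_body; do 3![apply: (exec_seq (tr1 := [:: _])); first exact: exec_do].
  apply: exec_seq run _.
  by apply: (exec_seq (tr1 := [:: _])); exact: exec_do.
- by rewrite !count_cat cnt_y cnt_x.
- by apply: stores_push => //=; rewrite s4X s4Y.
(* The reads move one unit from [t] to [x], keeping their sum, so the inner invariant starts at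
   [remaining (x :: l) t]. *)
by rewrite rem addSnnS prednK.
Qed.

Lemma exec_outer_loop (s : state) (l : seq nat) (t : nat) :
  0 < t -> var_val s K = Posz (size l).+1 -> stores (arr_val s) (t :: l) ->
  exists tr s',
    [/\ exec (While (K != 1%Z)%prog outer_body) s tr s',
        count_mem read_y tr = remaining l t &
        count_mem read_x tr = remaining l t].
Proof.
have [r] := ubnP (remaining l t).
elim: r s l t => // r IHr s [|x l] t lt_r t_gt0 sK sto_l.
  by exists [::], s; split => //; apply: exec_while_false; rewrite /= sK.
have [tr1 [s1 [l1 [t1 [run1 [cnt_y1 cnt_x1] [t1_gt0 s1K] sto1 rem]]]]] :=
  exec_outer_body _ _ _ _ t_gt0 sK sto_l.
have [||//|//|tr2 [s2 [run2 cnt_y2 cnt_x2]]] := IHr s1 l1 t1; try by lia.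
exists (tr1 ++ tr2), s2; split; last 2 first.
- by rewrite count_cat cnt_y1 cnt_y2 -rem.
- by rewrite count_cat cnt_x1 cnt_x2 -rem.
by apply: exec_while_true run1 run2; rewrite /= sK.
Qed.

Theorem theorem3p7 (n : nat) (n_gt0 : 0 < n) (s0 : state) :
  (exists tr s, exec (RuleAsc n) s0 tr s) /\
  (forall tr s, exec (RuleAsc n) s0 tr s ->
     count_mem read_y tr + count_mem read_x tr = 2 * num_partitions n).
Proof.
have [tr [s [run cnt]]] : exists tr s, exec (RuleAsc n) s0 tr s /\
    count_mem read_y tr + count_mem read_x tr = 2 * num_partitions n.
  set s1 := perform (K <~ 2%Z)%prog s0.
  set s2 := perform (a[1%Z]<~ 0%Z)%prog s1.
  set s3 := perform (a[2%Z]<~ Posz n)%prog s2.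
  (* With [a_1 = 0] below [n], [remaining] is [num_asc 1 n]: the sentinel 0 imposes parts at least
     1. *)
  have [//|//|tr [s [run cnt_y cnt_x]]] := @exec_outer_loop s3 [:: 0] n n_gt0.
  exists ([:: (K <~ 2%Z)%prog; (a[1%Z]<~ 0%Z)%prog; (a[2%Z]<~ Posz n)%prog] ++ tr), s.
  split.
    by do 3![apply: (exec_seq (tr1 := [:: _])); first exact: exec_do].
  by rewrite !count_cat cnt_y cnt_x num_partitions_asc mul2n -addnn /= !addn0.
split=> [|tr' s' run']; first by exists tr, s.
by have [<- _] := exec_deterministic _ _ _ _ _ _ run run'.
Qed.
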